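(* If $\Gamma\vdash\mathbf t:T$ is a derivable sequent of $\lambda^{\mathrm{vec}}_{\mathrm R}$, then $\mathbf t$ is strongly normalising, i.e. there is no infinite reduction sequence $\mathbf t\to\mathbf t_1\to\mathbf t_2\to\cdots$.
   Context: Fix a commutative ring $(\mathsf S,+,\times)$ of scalars. Terms: $\mathbf t ::= x\mid \lambda x.\mathbf t\mid (\mathbf t)\,\mathbf t\mid \alpha\cdot\mathbf t\mid \mathbf t+\mathbf t$, $\alpha\in\mathsf S$. Basis terms: $\mathbf b ::= x\mid\lambda x.\mathbf t$. The one-step reduction $\to$ is the closure under the contexts $\alpha\cdot[-]$, $\mathbf u+[-]$, $(\mathbf u)\,[-]$, $([-])\,\mathbf u$, $\lambda x.[-]$ of: $1\cdot\mathbf t\to\mathbf t$; $\alpha\cdot(\beta\cdot\mathbf t)\to(\alpha\times\beta)\cdot\mathbf t$; $\alpha\cdot(\mathbf t+\mathbf r)\to\alpha\cdot\mathbf t+\alpha\cdot\mathbf r$; $\alpha\cdot\mathbf t+\beta\cdot\mathbf t\to(\alpha+\beta)\cdot\mathbf t$; $\alpha\cdot\mathbf t+\mathbf t\to(\alpha+1)\cdot\mathbf t$; $\mathbf t+\mathbf t\to(1+1)\cdot\mathbf t$; $(\mathbf t+\mathbf r)\,\mathbf u\to(\mathbf t)\,\mathbf u+(\mathbf r)\,\mathbf u$; $(\mathbf t)\,(\mathbf r+\mathbf u)\to(\mathbf t)\,\mathbf r+(\mathbf t)\,\mathbf u$; $(\alpha\cdot\mathbf t)\,\mathbf r\to\alpha\cdot(\mathbf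 t)\,\mathbf r$; $(\mathbf t)\,(\alpha\cdot\mathbf r)\to\alpha\cdot(\mathbf t)\,\mathbf r$; $(\lambda x.\mathbf t)\,\mathbf b\to\mathbf t[\mathbf b/x]$ for basis terms $\mathbf b$. Types: general $T::=U\mid\alpha\cdot T\mid T+T\mid\mathbb X$, unit $U::=X\mid U\to T\mid\forall X.U\mid\forall\mathbb X.U$ ($X$ unit type variables, $\mathbb X$ general type variables). $\equiv$ is the smallest congruence with $1\cdot T\equiv T$, $\alpha\cdot(\beta\cdot T)\equiv(\alpha\times\beta)\cdot T$, $\alpha\cdot T+\alpha\cdot R\equiv\alpha\cdot(T+R)$, $\alpha\cdot T+\beta\cdot T\equiv(\alpha+\beta)\cdot T$, $T+R\equiv R+T$, $T+(R+S)\equiv(T+R)+S$. In $T[A/X]$, $A$ is unit when $X$ is a unit variable. Contexts are finite sets of $x:U$ with $U$ unit. Typing rules: (ax) $\Gamma,x:U\vdash x:U$; ($\equiv$) from $\Gamma\vdash\mathbf t:T$, $R\equiv T$ infer $\Gamma\vdash\mathbf t:R$; ($\to_I$) from $\Gamma,x:U\vdash\mathbf t:T$ infer $\Gamma\vdash\lambda x.\mathbf t:U\to T$; ($\to_E$) from $\Gamma\vdash\mathbf t:\sum_{i=1}^n\alpha_i\cdot\forall\vec X.(U\to T_i)$ and $\Gamma\vdash\mathbf r:\sum_{j=1}^m\beta_j\cdot U[\vec A_j/\vec X]$ infer $\Gamma\vdash(\mathbf t)\,\mathbf r:\sum_{i}\sum_{j}(\alpha_i\times\beta_j)\cdot T_i[\vec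 A_j/\vec X]$; ($\forall_I$) from $\Gamma\vdash\mathbf t:\sum_i\alpha_i\cdot U_i$, $X\notin FV(\Gamma)$ infer $\Gamma\vdash\mathbf t:\sum_i\alpha_i\cdot\forall X.U_i$; ($\forall_E$) from $\Gamma\vdash\mathbf t:\sum_i\alpha_i\cdot\forall X.U_i$ infer $\Gamma\vdash\mathbf t:\sum_i\alpha_i\cdot U_i[A/X]$; ($+_I$) from $\Gamma\vdash\mathbf t:T$, $\Gamma\vdash\mathbf r:R$ infer $\Gamma\vdash\mathbf t+\mathbf r:T+R$; ($1_E$) from $\Gamma\vdash1\cdot\mathbf t:T$ infer $\Gamma\vdash\mathbf t:T$; ($S$) from $\Gamma\vdash\mathbf t:T_i$ for all $i\in\{1,\dots,n\}$ infer $\Gamma\vdash(\sum_i\alpha_i)\cdot\mathbf t:\sum_i\alpha_i\cdot T_i$. *)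

(* Defs.v *)
From mathcomp Require Import all_boot all_algebra.

Set Implicit Arguments.
Unset Strict Implicit.
Unset Printing Implicit Defensive.

Local Open Scope ring_scope.

(** * Terms

    Terms are in de Bruijn style: [Var 0] is bound by the innermost [Lam]. *)

Inductive term (K : Type) : Type :=
| Var of nat
| Lam of term K
| App of term K & term K
| Scale of K & term K
| Add of term K & term K.

Arguments Var {K} _.

Definition basis (K : Type) (t : term K) : bool :=
  match t with Var _ | Lam _ => true | _ => false end.

Definition scons (A : Type) (a : A) (f : nat -> A) (n : nat) : A :=
  if n is m.+1 then f m else a.

Definition upren (xi : nat -> nat) : nat -> nat := scons 0%N (succn \o xi).

Fixpoint tren (K : Type) (xi : nat -> nat) (t : term K) : term K :=
  match t with
  | Var n => Var (xi n)
  | Lam t => Lam (tren (upren xi) t)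
  | App t u => App (tren xi t) (tren xi u)
  | Scale a t => Scale a (tren xi t)
  | Add t u => Add (tren xi t) (tren xi u)
  end.

Definition tup (K : Type) (s : nat -> term K) : nat -> term K :=
  scons (Var 0) (tren succn \o s).

Fixpoint tsubst (K : Type) (s : nat -> term K) (t : term K) : term K :=
  match t with
  | Var n => s n
  | Lam t => Lam (tsubst (tup s) t)
  | App t u => App (tsubst s t) (tsubst s u)
  | Scale a t => Scale a (tsubst s t)
  | Add t u => Add (tsubst s t) (tsubst s u)
  end.

(** [tinst b t] is [t[b/x]], where [x] is the variable of index [0] in [t]. *)
Definition tinst (K : Type) (b t : term K) : term K := tsubst (scons b Var) t.

Inductive red (K : comPzRingType) : term K -> term K -> Prop :=
| red_one t : red (Scale 1 t) t
| red_scale_scale a b t : red (Scale a (Scale b t)) (Scale (a * b) t)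
| red_scale_add a t r : red (Scale a (Add t r)) (Add (Scale a t) (Scale a r))
| red_fact a b t : red (Add (Scale a t) (Scale b t)) (Scale (a + b) t)
| red_fact1 a t : red (Add (Scale a t) t) (Scale (a + 1) t)
| red_fact11 t : red (Add t t) (Scale (1 + 1) t)
| red_app_addl t r u : red (App (Add t r) u) (Add (App t u) (App r u))
| red_app_addr t r u : red (App t (Add r u)) (Add (App t r) (App t u))
| red_app_scalel a t r : red (App (Scale a t) r) (Scale a (App t r))
| red_app_scaler a t r : red (App t (Scale a r)) (Scale a (App t r))
| red_beta t b : basis b -> red (App (Lam t) b) (tinst b t)
| red_in_scale a t t' : red t t' -> red (Scale a t) (Scale a t')
| red_in_add u t t' : red t t' -> red (Add u t) (Add u t')
| red_in_appr u t t' : red t t' -> red (App u t) (App u t')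
| red_in_appl u t t' : red t t' -> red (App t u) (App t' u)
| red_in_lam t t' : red t t' -> red (Lam t) (Lam t').

(** As usual for the linear-algebraic lambda-calculus, [+] is an
    associative-commutative symbol on terms.  This is why the factorisation
    rules and the context [u + [-]] above have no mirror images. *)
Inductive ac_eq (K : Type) : term K -> term K -> Prop :=
| ac_addC t r : ac_eq (Add t r) (Add r t)
| ac_addA t r u : ac_eq (Add t (Add r u)) (Add (Add t r) u)
| ac_refl t : ac_eq t t
| ac_sym t r : ac_eq t r -> ac_eq r t
| ac_trans t r u : ac_eq t r -> ac_eq r u -> ac_eq t u
| ac_lam t t' : ac_eq t t' -> ac_eq (Lam t) (Lam t')
| ac_app t t' u u' : ac_eq t t' -> ac_eq u u' -> ac_eq (App t u) (App t' u')
| ac_scale a t t' : ac_eq t t' -> ac_eq (Scale a t) (Scale a t')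
| ac_add t t' u u' : ac_eq t t' -> ac_eq u u' -> ac_eq (Add t u) (Add t' u').

Definition red_ac (K : comPzRingType) (t t' : term K) : Prop :=
  exists s s', [/\ ac_eq t s, red s s' & ac_eq s' t'].

Lemma red_red_ac (K : comPzRingType) (t t' : term K) : red t t' -> red_ac t t'.
Proof. by move=> tt'; exists t, t'; split=> //; apply: ac_refl. Qed.

Definition strongly_normalising (K : comPzRingType) (t : term K) : Prop :=
  ~ exists f : nat -> term K, f 0%N = t /\ forall n, red_ac (f n) (f n.+1).

(** * Types

    Unit and general type variables are de Bruijn indices in two separate
    namespaces: [UAll] binds unit variable 0, [UAllG] general variable 0. *)

Inductive uty (K : Type) : Type :=
| UVar of nat
| UArr of uty K & gty K
| UAll of uty K
| UAllG of uty K
with gty (K : Type) : Type :=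
| GUnit of uty K
| GScale of K & gty K
| GAdd of gty K & gty K
| GVar of nat.

Arguments UVar {K} _.
Arguments GVar {K} _.

Fixpoint uren (K : Type) (xu xg : nat -> nat) (U : uty K) : uty K :=
  match U with
  | UVar n => UVar (xu n)
  | UArr U T => UArr (uren xu xg U) (gren xu xg T)
  | UAll U => UAll (uren (upren xu) xg U)
  | UAllG U => UAllG (uren xu (upren xg) U)
  end
with gren (K : Type) (xu xg : nat -> nat) (T : gty K) : gty K :=
  match T with
  | GUnit U => GUnit (uren xu xg U)
  | GScale a T => GScale a (gren xu xg T)
  | GAdd T R => GAdd (gren xu xg T) (gren xu xg R)
  | GVar n => GVar (xg n)
  end.

Fixpoint usubst (K : Type) (su : nat -> uty K) (sg : nat -> gty K) (U : uty K)
    : uty K :=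
  match U with
  | UVar n => su n
  | UArr U T => UArr (usubst su sg U) (gsubst su sg T)
  | UAll U => UAll (usubst (scons (UVar 0) (uren succn id \o su))
                           (gren succn id \o sg) U)
  | UAllG U => UAllG (usubst (uren id succn \o su)
                             (scons (GVar 0) (gren id succn \o sg)) U)
  end
with gsubst (K : Type) (su : nat -> uty K) (sg : nat -> gty K) (T : gty K)
    : gty K :=
  match T with
  | GUnit U => GUnit (usubst su sg U)
  | GScale a T => GScale a (gsubst su sg T)
  | GAdd T R => GAdd (gsubst su sg T) (gsubst su sg R)
  | GVar n => sg n
  end.

(** A type variable [X] of either sort, and the types [A] that may replace it. *)
Inductive vsort := SUnit | SGen.

Inductive targ (K : Type) : Type :=
| AUnit of uty K
| AGen of gty K.

Definition sort_of (K : Type) (A : targ K) : vsort :=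
  if A is AUnit _ then SUnit else SGen.

Definition uall (K : Type) (s : vsort) (U : uty K) : uty K :=
  if s is SUnit then UAll U else UAllG U.

(** [forall X1 ... Xk. U], the head of the list being the outermost [X1]. *)
Definition ualls (K : Type) (Xs : seq vsort) (U : uty K) : uty K :=
  foldr (@uall K) U Xs.

(** The simultaneous substitution [A1/X1, ..., Ak/Xk] for the body [U] of
    [forall X1 ... Xk. U]: the last argument replaces the lowest index. *)
Definition inst_env (K : Type) (As : seq (targ K))
    : (nat -> uty K) * (nat -> gty K) :=
  foldl (fun s A => match A with
                    | AUnit U => (scons U s.1, s.2)
                    | AGen T => (s.1, scons T s.2)
                    end) (UVar, GVar) As.

Definition uinst (K : Type) (As : seq (targ K)) (U : uty K) : uty K :=
  usubst (inst_env As).1 (inst_env As).2 U.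

Definition ginst (K : Type) (As : seq (targ K)) (T : gty K) : gty K :=
  gsubst (inst_env As).1 (inst_env As).2 T.

(** Weakening by a fresh type variable of the given sort. *)
Definition ushift (K : Type) (s : vsort) : uty K -> uty K :=
  if s is SUnit then uren succn id else uren id succn.

Inductive gequiv (K : comPzRingType) : gty K -> gty K -> Prop :=
| eqv_one T : gequiv (GScale 1 T) T
| eqv_scale_scale a b T : gequiv (GScale a (GScale b T)) (GScale (a * b) T)
| eqv_scale_add a T R :
    gequiv (GAdd (GScale a T) (GScale a R)) (GScale a (GAdd T R))
| eqv_fact a b T : gequiv (GAdd (GScale a T) (GScale b T)) (GScale (a + b) T)
| eqv_addC T R : gequiv (GAdd T R) (GAdd R T)
| eqv_addA T R V : gequiv (GAdd T (GAdd R V)) (GAdd (GAdd T R) V)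
| eqv_refl T : gequiv T T
| eqv_sym T R : gequiv T R -> gequiv R T
| eqv_trans T R V : gequiv T R -> gequiv R V -> gequiv T V
| eqv_arr U U' T T' :
    gequiv (GUnit U) (GUnit U') -> gequiv T T' ->
    gequiv (GUnit (UArr U T)) (GUnit (UArr U' T'))
| eqv_all s U U' :
    gequiv (GUnit U) (GUnit U') ->
    gequiv (GUnit (uall s U)) (GUnit (uall s U'))
| eqv_scale a T T' : gequiv T T' -> gequiv (GScale a T) (GScale a T')
| eqv_add T T' R R' :
    gequiv T T' -> gequiv R R' -> gequiv (GAdd T R) (GAdd T' R').

(** [gsum n F] is [F 0 + ... + F n]: there is no empty sum of types, so a sum
    of [n.+1] summands is indexed by [0, ..., n]. *)
Fixpoint gsum (K : Type) (n : nat) (F : nat -> gty K) : gty K :=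
  if n is m.+1 then GAdd (gsum m F) (F m.+1) else F 0%N.

(** * Typing

    A context lists the types of the free variables [Var 0], [Var 1], ...
    The side condition [X \notin FV(Gamma)] of [forall_I] is expressed by
    weakening [Gamma] with the variable to be bound. *)

Inductive typing (K : comPzRingType)
    : seq (uty K) -> term K -> gty K -> Prop :=
| ty_ax Gamma x U :
    onth Gamma x = Some U ->
    typing Gamma (Var x) (GUnit U)
| ty_equiv Gamma t T R :
    typing Gamma t T -> gequiv R T ->
    typing Gamma t R
| ty_arrI Gamma U t T :
    typing (U :: Gamma) t T ->
    typing Gamma (Lam t) (GUnit (UArr U T))
| ty_arrE Gamma t r (Xs : seq vsort) U
    n (alpha : nat -> K) (T : nat -> gty K)
    m (beta : nat -> K) (A : nat -> seq (targ K)) :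
    (forall j, (j <= m)%N -> map (@sort_of K) (A j) = Xs) ->
    typing Gamma t
      (gsum n (fun i => GScale (alpha i) (GUnit (ualls Xs (UArr U (T i)))))) ->
    typing Gamma r
      (gsum m (fun j => GScale (beta j) (GUnit (uinst (A j) U)))) ->
    typing Gamma (App t r)
      (gsum n (fun i => gsum m (fun j =>
         GScale (alpha i * beta j) (ginst (A j) (T i)))))
| ty_allI Gamma t (X : vsort) n (alpha : nat -> K) (U : nat -> uty K) :
    typing (map (@ushift K X) Gamma) t
      (gsum n (fun i => GScale (alpha i) (GUnit (U i)))) ->
    typing Gamma t
      (gsum n (fun i => GScale (alpha i) (GUnit (uall X (U i)))))
| ty_allE Gamma t (A : targ K) n (alpha : nat -> K) (U : nat -> uty K) :
    typing Gamma t
      (gsum n (fun i => GScale (alpha i) (GUnit (uall (sort_of A) (U i))))) ->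
    typing Gamma t
      (gsum n (fun i => GScale (alpha i) (GUnit (uinst [:: A] (U i)))))
| ty_addI Gamma t r T R :
    typing Gamma t T -> typing Gamma r R ->
    typing Gamma (Add t r) (GAdd T R)
| ty_oneE Gamma t T :
    typing Gamma (Scale 1 t) T ->
    typing Gamma t T
| ty_S Gamma t n (alpha : nat -> K) (T : nat -> gty K) :
    (forall i, (i <= n)%N -> typing Gamma t (T i)) ->
    typing Gamma (Scale (\sum_(i < n.+1) alpha i) t)
      (gsum n (fun i => GScale (alpha i) (T i))).

(* Main.v *)
Require Import Defs.
From Stdlib Require Import Permutation Relation_Operators Transitive_Closure.
From Stdlib Require Import Classical FunctionalExtensionality PropExtensionality.
From mathcomp Require Import all_boot all_algebra zify.

(** Values are interpreted by reducibility sets and a sum of types by the union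
    of its components: a term belongs to [T] when it is strongly normalising and
    the abstractions among the summands of its reducts lie in a component of
    [T]; scalars play no role.  The delicate rule is the introduction of a
    quantifier under a sum, which needs the intersection over all candidates to
    commute with finite unions.  For plain sets of terms it need not.  So the
    candidates are families indexed by the points of a Kripke frame, and the
    quantifier ranges over all candidates on all frames lying over the current
    one by a p-morphism: counterexamples for the components of a sum then live
    on different frames, which can be glued below a common point.  Sums
    themselves are handled by the multiset order on their summands. *)

Set Implicit Arguments.
Unset Strict Implicit.
Unset Printing Implicit Defensive.

Local Open Scope ring_scope.

(** * The multiset order *)

Section Multiset.
Variables (A : Type) (R : A -> A -> Prop).

(** One step of the Dershowitz-Manna order, on lists modulo permutation; [ys] may be empty, so
    deleting an element is a step. *)
Definition mset_lt (l' l : list A) : Prop :=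
  exists x c ys, [/\ Permutation l (x :: c), Permutation l' (ys ++ c)
                   & forall y, List.In y ys -> R y x].

Lemma Acc_mset_lt_perm l l' :
  Permutation l l' -> Acc mset_lt l -> Acc mset_lt l'.
Proof.
move=> ll' [accl]; constructor=> m [x [c [ys [p q r]]]]; apply: accl.
by exists x, c, ys; split=> //; apply: Permutation_trans ll' p.
Qed.

(** Outer induction on [a], inner induction on [l]. A step that removes [a] adds elements below [a],
    restored one at a time by the outer induction; any other step happens in [l] and falls under the
    inner one. *)
Lemma Acc_mset_lt_cons a :
  Acc R a -> forall l, Acc mset_lt l -> Acc mset_lt (a :: l).
Proof.
elim=> {}a _ IHa l; elim=> {}l accl IHl.
constructor=> m [x [c [ys [p q r]]]].
apply: (Acc_mset_lt_perm (Permutation_sym q)).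
have [ax|ac] : List.In a (x :: c) by apply: (Permutation_in _ p); left.
  rewrite ax in p; have lc := Permutation_cons_inv p.
  have {}accl : Acc mset_lt c by apply: (Acc_mset_lt_perm lc); constructor.
  elim: ys {q} r => [|y ys IHys] r; first exact: accl.
  apply: IHa; first by rewrite -ax; apply: r; left.
  by apply: IHys => z zin; apply: r; right.
have [c1 [c2 cE]] := List.in_split _ _ ac.
have cP : Permutation c (a :: (c1 ++ c2)).
  by rewrite cE; apply/Permutation_sym/Permutation_middle.
apply: (@Acc_mset_lt_perm (a :: (ys ++ (c1 ++ c2)))).
  apply: (Permutation_trans (Permutation_middle _ _ _)).
  exact: Permutation_app_head (Permutation_sym cP).
apply: IHl; exists x, (c1 ++ c2), ys; split=> //.
apply: (@Permutation_cons_inv _ _ _ a); apply: (Permutation_trans p).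
exact: (Permutation_trans (Permutation.perm_skip _ cP) (Permutation.perm_swap _ _ _)).
Qed.

Lemma Acc_mset_lt l :
  (forall x, List.In x l -> Acc R x) -> Acc mset_lt l.
Proof.
elim: l => [|x l IHl] accl.
  by constructor=> m [x [c [ys [/Permutation_nil]]]].
apply: Acc_mset_lt_cons; first by apply: accl; left.
by apply: IHl => y yl; apply: accl; right.
Qed.

Definition mset_ltp := clos_trans (list A) mset_lt.

Lemma mset_ltp_perm l1 l2 l1' l2' :
  Permutation l1 l1' -> Permutation l2 l2' -> mset_ltp l1 l2 -> mset_ltp l1' l2'.
Proof.
move=> p1 p2 lt12; elim: lt12 l1' l2' p1 p2 => {l1 l2}.
  move=> l1 l2 [x [c [ys [p q r]]]] l1' l2' p1 p2.
  apply: t_step; exists x, c, ys; split=> //.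
    exact: Permutation_trans (Permutation_sym p2) p.
  exact: Permutation_trans (Permutation_sym p1) q.
move=> l1 l2 l3 _ IH1 _ IH2 l1' l3' p1 p3.
by apply: t_trans (IH1 _ _ p1 (Permutation_refl _))
                  (IH2 _ _ (Permutation_refl _) p3).
Qed.

Lemma mset_ltp_catl s l1 l2 : mset_ltp l1 l2 -> mset_ltp (s ++ l1) (s ++ l2).
Proof.
elim=> {l1 l2} [l1 l2 [x [c [ys [p q r]]]]|l1 l2 l3 _ IH1 _ IH2]; last first.
  exact: t_trans IH1 IH2.
apply: t_step; exists x, (s ++ c), ys; split=> //.
  apply: Permutation_trans (Permutation_app_head s p) _.
  exact/Permutation_sym/Permutation_middle.
apply: Permutation_trans (Permutation_app_head s q) _.
exact: Permutation_app_swap_app.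
Qed.

Lemma mset_ltp_drop s l : s <> [::] -> mset_ltp l (s ++ l).
Proof.
have drop1 x m : mset_ltp m (x :: m) by apply: t_step; exists x, m, [::].
case: s => // x s _; elim: s x => [|y s IHs] x //=.
exact: t_trans (IHs y) (drop1 _ _).
Qed.

End Multiset.

(** * Substitution *)

Section Terms.
Variable K : comPzRingType.
Implicit Types (t u r b : term K) (s : nat -> term K).

Lemma scons_comp (A B : Type) (h : A -> B) a (f : nat -> A) :
  h \o scons a f = scons (h a) (h \o f).
Proof. by apply: functional_extensionality; case. Qed.

Lemma upren_comp xi zeta : upren zeta \o upren xi = upren (zeta \o xi).
Proof. by apply: functional_extensionality; case. Qed.

Lemma tren_tren xi zeta t : tren zeta (tren xi t) = tren (zeta \o xi) t.
Proof.
elim: t xi zeta => //= [t IH|t IHt u IHu|a t IH|t IHt u IHu] xi zeta;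
  by rewrite ?IH ?IHt ?IHu ?upren_comp.
Qed.

Lemma tup_upren s xi : tup s \o upren xi = tup (s \o xi).
Proof. by apply: functional_extensionality; case. Qed.

Lemma tsubst_tren s xi t : tsubst s (tren xi t) = tsubst (s \o xi) t.
Proof.
elim: t s xi => //= [t IH|t IHt u IHu|a t IH|t IHt u IHu] s xi;
  by rewrite ?IH ?IHt ?IHu ?tup_upren.
Qed.

Lemma tren_tup s xi : tren (upren xi) \o tup s = tup (tren xi \o s).
Proof.
apply: functional_extensionality; case=> //= n.
by rewrite !tren_tren.
Qed.

Lemma tren_tsubst s xi t : tren xi (tsubst s t) = tsubst (tren xi \o s) t.
Proof.
elim: t s xi => //= [t IH|t IHt u IHu|a t IH|t IHt u IHu] s xi;
  by rewrite ?IH ?IHt ?IHu ?tren_tup.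
Qed.

Lemma tsubst_tup s1 s2 : tsubst (tup s2) \o tup s1 = tup (tsubst s2 \o s1).
Proof.
apply: functional_extensionality; case=> //= n.
by rewrite tsubst_tren tren_tsubst.
Qed.

Lemma tsubst_tsubst s1 s2 t : tsubst s2 (tsubst s1 t) = tsubst (tsubst s2 \o s1) t.
Proof.
elim: t s1 s2 => //= [t IH|t IHt u IHu|a t IH|t IHt u IHu] s1 s2;
  by rewrite ?IH ?IHt ?IHu ?tsubst_tup.
Qed.

Lemma tsubst_Var t : tsubst Var t = t.
Proof.
have tupV : tup Var = @Var K by apply: functional_extensionality; case.
by elim: t => //= [t IH|t IHt u IHu|a t IH|t IHt u IHu];
  rewrite ?tupV ?IH ?IHt ?IHu.
Qed.

Lemma tinst_tup b s t : tinst b (tsubst (tup s) t) = tsubst (scons b s) t.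
Proof.
rewrite /tinst tsubst_tsubst; congr (tsubst _ t).
apply: functional_extensionality; case=> //= n.
by rewrite tsubst_tren; apply: tsubst_Var.
Qed.

Lemma tsubst_tinst b s t :
  tsubst s (tinst b t) = tinst (tsubst s b) (tsubst (tup s) t).
Proof. by rewrite tinst_tup /tinst tsubst_tsubst scons_comp. Qed.

Lemma basis_tsubst s b : (forall n, basis (s n)) -> basis b -> basis (tsubst s b).
Proof. by case: b => //= n ->. Qed.

Lemma basis_tup s : (forall n, basis (s n)) -> forall n, basis (tup s n).
Proof. by move=> bs [|n] //=; case: (s n) (bs n). Qed.

(** Replacing variables by basis terms keeps the argument of a beta redex a basis term, so the redex
    survives. *)
Lemma red_tsubst s t u :
  (forall n, basis (s n)) -> red t u -> red (tsubst s t) (tsubst s u).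
Proof.
move=> bs tu; elim: tu s bs => /= {t u}; try by move=> *; constructor; auto.
  by move=> t b bb s bs; rewrite tsubst_tinst; constructor; apply: basis_tsubst.
by move=> t t' _ IH s bs; constructor; apply: IH; apply: basis_tup.
Qed.

(** * Reduction modulo associativity and commutativity *)

Lemma ac_tsubst s t u : ac_eq t u -> ac_eq (tsubst s t) (tsubst s u).
Proof.
move=> tu; elim: tu s => /= {t u}; try by move=> *; constructor; auto.
by move=> t r u _ IH1 _ IH2 s; apply: ac_trans (IH1 s) (IH2 s).
Qed.

Lemma red_ac_tsubst s t u :
  (forall n, basis (s n)) -> red_ac t u -> red_ac (tsubst s t) (tsubst s u).
Proof.
move=> bs [t1 [u1 [tt1 t1u1 u1u]]]; exists (tsubst s t1), (tsubst s u1).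
by split; [apply: ac_tsubst | apply: red_tsubst | apply: ac_tsubst].
Qed.

Lemma basis_scons b s :
  basis b -> (forall n, basis (s n)) -> forall n, basis (scons b s n).
Proof. by move=> bb bs []. Qed.

Lemma red_ac_tinst b t u : basis b -> red_ac t u -> red_ac (tinst b t) (tinst b u).
Proof. by move=> bb; apply/red_ac_tsubst/basis_scons. Qed.

Lemma ac_red_ac t u r : ac_eq t u -> red_ac u r -> red_ac t r.
Proof.
move=> tu [s [s' [us ss' s'r]]]; exists s, s'; split=> //.
exact: ac_trans tu us.
Qed.

(** [ac_sym] and [ac_trans] defeat plain inversion; the match is an invariant that every rule
    preserves. *)
Lemma ac_eq_inv t u : ac_eq t u ->
  match t, u with
  | Var n, Var m => n = m
  | Lam a, Lam b => ac_eq a b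
  | App a1 a2, App b1 b2 => ac_eq a1 b1 /\ ac_eq a2 b2
  | Scale x a, Scale y b => x = y /\ ac_eq a b
  | Add _ _, Add _ _ => True
  | _, _ => False
  end.
Proof.
elim=> {t u} //.
- by case=> //= *; do ?split; apply: ac_refl.
- by move=> t u _; case: t; case: u => //= *; intuition auto using ac_sym.
- move=> t u r _ + _; case: t => [n|a|a a'|x a|a a']; 
    case: u => [m|b|b b'|y b|b b'] //; case: r => [p|c|c c'|z c|c c'] //.
  + by move=> ->.
  + exact: ac_trans.
  + by move=> [ab ab'] [bc bc']; split; [apply: ac_trans bc | apply: ac_trans bc'].
  + by move=> [-> ab] [-> bc]; split=> //; apply: ac_trans bc.
Qed.

Lemma ac_eq_class t u : ac_eq t u -> ac_eq t = ac_eq u.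
Proof.
move=> tu; apply: functional_extensionality => r; apply: propositional_extensionality.
by split; apply: ac_trans => //; apply: ac_sym.
Qed.

Lemma ac_Lam_inv t u : ac_eq (Lam t) u -> exists2 t', u = Lam t' & ac_eq t t'.
Proof. by move/ac_eq_inv; case: u => // t' tt'; exists t'. Qed.

Lemma ac_App_inv t r u : ac_eq (App t r) u ->
  exists t' r', [/\ u = App t' r', ac_eq t t' & ac_eq r r'].
Proof. by move/ac_eq_inv; case: u => // t' r' [? ?]; exists t', r'. Qed.

Lemma red_ac_Lam_inv t u :
  red_ac (Lam t) u -> exists2 t', u = Lam t' & red_ac t t'.
Proof.
case=> s [s' [/ac_Lam_inv [t1 -> tt1] st]].
inversion st as [| | | | | | | | | | | | | | | t1' t2 r12] => {st}; subst.
by move=> /ac_Lam_inv[t' -> t2t']; exists t' => //; exists t1, t2.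
Qed.

Lemma red_ac_Var n u : ~ red_ac (Var n) u.
Proof.
by move=> [s [s' [/ac_eq_inv ns st _]]]; case: s ns st => // m _ st; inversion st.
Qed.

(** * Hereditarily good terms *)

Definition child x t : Prop :=
  match t with
  | Add a b => x = a \/ x = b
  | Scale _ a => x = a
  | _ => False
  end.

(* [V] is a set of bodies of abstractions.  The condition on summands says
   nothing new about a strongly normalising term, but it makes the induction
   on [good] descend through the skeleton of sums and scalars as well. *)
Inductive good (V : term K -> Prop) t : Prop :=
  Good of (forall a, ac_eq t (Lam a) -> V a)
        & (forall u x, ac_eq t u -> child x u -> good V x)
        & (forall u, red_ac t u -> good V u).

Lemma good_ac V t u : good V t -> ac_eq t u -> good V u.
Proof.
move=> [GV Gc Gr] tu; split.
- by move=> a ua; apply: GV (ac_trans tu ua).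
- by move=> v x uv; apply: Gc (ac_trans tu uv).
- by move=> v uv; apply/Gr/(ac_red_ac tu).
Qed.

Lemma good_red V t u : good V t -> red_ac t u -> good V u.
Proof. by case=> _ _ Gr /Gr. Qed.

Lemma good_child V t x : good V t -> child x t -> good V x.
Proof. by case=> _ Gc _; apply: Gc (ac_refl t). Qed.

Lemma good_body V a : good V (Lam a) -> V a.
Proof. by case=> GV _ _; apply: GV (ac_refl _). Qed.

Lemma good_sub (V W : term K -> Prop) t :
  (forall a, V a -> W a) -> good V t -> good W t.
Proof. by move=> VW; elim=> {}t GV _ IHc _ IHr; split=> // a /GV /VW. Qed.

(** All members of [P] speak of the same reducts, so induction on goodness for one of them carries
    the others along. The given member [V] provides the termination to induct on. *)
Lemma good_inter (P : (term K -> Prop) -> Prop) (V W : term K -> Prop) t :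
  P V -> (forall V, P V -> good V t) ->
  (forall a, (forall V, P V -> V a) -> W a) -> good W t.
Proof.
move=> PV GP PW; elim: (GP V PV) (GP) => {GP}t _ _ IHc _ IHr GP; split.
- by move=> a ta; apply: PW => V' /GP[GV _ _]; apply: GV.
- move=> u x tu xu; apply: (IHc u x tu xu) => V' /GP[_ Gc _]; exact: Gc xu.
- move=> u tu; apply: (IHr u tu) => V' /GP[_ _ Gr]; exact: Gr.
Qed.

Lemma good_Var V n : good V (Var n).
Proof.
split=> [a /ac_eq_inv//|u x /ac_eq_inv|u /red_ac_Var//].
by case: u.
Qed.

Definition SN t := Acc (fun u u' => red_ac u' u) t.

Lemma good_SN V t : good V t -> SN t.
Proof. by elim=> {}t _ _ _ _ IH; constructor. Qed.

Lemma SN_tinst_inv b t : basis b -> SN (tinst b t) -> SN t.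
Proof.
move=> bb; move Eu: (tinst b t) => u Su; elim: Su t Eu => {}u _ IH t Eu.
constructor=> t' tt'; apply: IH (erefl _); rewrite -Eu.
exact: red_ac_tinst.
Qed.

Lemma SN_body t : SN (Lam t) -> SN t.
Proof.
move Eu: (Lam t) => u Su; elim: Su t Eu => {}u _ IH t Eu.
constructor=> t' [s [s' [ts ss' s't']]]; apply: IH (erefl _); rewrite -Eu.
exists (Lam s), (Lam s'); split; first exact: ac_lam.
  exact: red_in_lam.
exact: ac_lam.
Qed.

Definition stable (V : term K -> Prop) : Prop :=
  (forall a b, V a -> ac_eq a b -> V b) /\ (forall a b, V a -> red_ac a b -> V b).

Lemma good_Lam V a : stable V -> SN a -> V a -> good V (Lam a).
Proof.
move=> [Vac Vred]; elim=> {}a _ IH Va; split.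
- by move=> b /ac_eq_inv /Vac; apply.
- by move=> u x /ac_Lam_inv[b -> _].
- by move=> u /red_ac_Lam_inv[b -> ab]; apply: IH (Vred _ _ Va ab).
Qed.

Lemma SN_no_infinite t : SN t -> strongly_normalising t.
Proof.
elim=> {}t _ IH [f [f0 fS]]; apply: (IH (f 1%N)); first by rewrite -f0.
by exists (f \o succn); split=> // n; apply: fS.
Qed.

(** * Goodness is determined by the leaves *)

(* A leaf is represented by its class [ac_eq l], so that the leaves of AC-equal
   terms are permutations of each other. *)
Fixpoint leaves t : list (term K -> Prop) :=
  match t with
  | Add a b => leaves a ++ leaves b
  | Scale _ a => leaves a
  | _ => [:: ac_eq t]
  end.

(** A measure for the scalar rules that keep the leaves. The constant 2 at a sum pays for the
    duplicated scalar: distribution turns the constant [2 * 2 + 1] into [1 + 1 + 2]. *)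
Fixpoint weight t : nat :=
  match t with
  | Add a b => (weight a + weight b + 2)%N
  | Scale _ a => (2 * weight a + 1)%N
  | _ => 0%N
  end.

Definition leaf_lt (d c : term K -> Prop) : Prop :=
  exists a a', [/\ c = ac_eq a, red_ac a a' & List.In d (leaves a')].

Lemma leaves_nonempty t : leaves t <> [::].
Proof. by elim: t => //= t + u _; case: (leaves t). Qed.

Lemma leaves_ac t u : ac_eq t u -> Permutation (leaves t) (leaves u).
Proof.
elim=> {t u} //=; try by move=> *; apply: Permutation_refl.
- by move=> *; apply: Permutation_app_comm.
- by move=> t r u; rewrite catA; apply: Permutation_refl.
- by move=> t r _; apply: Permutation_sym.
- by move=> t r u _ + _; apply: Permutation_trans.
- by move=> t u /ac_lam /ac_eq_class -> _; apply: Permutation_refl.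
- move=> t t' u u' tt' _ uu' _; rewrite (ac_eq_class (ac_app tt' uu')).
  exact: Permutation_refl.
- by move=> t t' u u' _ + _; apply: Permutation_app.
Qed.

Lemma weight_ac t u : ac_eq t u -> weight t = weight u.
Proof. by elim=> {t u} //= *; lia. Qed.

(** Applications and abstractions are leaves, so a step at or inside one replaces a leaf by the
    leaves of its reduct. Factorisation drops a nonempty list of leaves. The other scalar rules keep
    the leaves and lower the weight. *)
Lemma red_leaves t u : red t u ->
  mset_ltp leaf_lt (leaves u) (leaves t) \/
  leaves u = leaves t /\ (weight u < weight t)%N.
Proof.
have one a a' : red a a' -> leaves a = [:: ac_eq a] ->
    mset_ltp leaf_lt (leaves a') (leaves a).
  move=> aa' ->; apply: t_step; exists (ac_eq a), [::], (leaves a').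
  split; rewrite ?cats0 //; try exact: Permutation_refl.
  by move=> y yin; exists a, a'; split=> //; apply: red_red_ac.
elim=> {t u}; try by move=> *; left; apply: one => //; constructor.
- by move=> t; right; split=> //=; lia.
- by move=> a b t; right; split=> //=; lia.
- by move=> a t r; right; split=> //=; lia.
- by move=> a b t; left; apply/mset_ltp_drop/leaves_nonempty.
- by move=> a t; left; apply/mset_ltp_drop/leaves_nonempty.
- by move=> t; left; apply/mset_ltp_drop/leaves_nonempty.
- move=> a t t' _ /= [lt|[-> lt]]; [by left|right; split=> //=; lia].
- move=> v t t' _ /= [lt|[-> lt]]; last by right; split=> //=; lia.
  by left; apply: mset_ltp_catl.
Qed.

Lemma red_ac_leaves t u : red_ac t u ->
  mset_ltp leaf_lt (leaves u) (leaves t) \/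
  Permutation (leaves u) (leaves t) /\ (weight u < weight t)%N.
Proof.
move=> [s [s' [ts /red_leaves ss' s'u]]].
rewrite (weight_ac ts) -(weight_ac s'u).
have pt := Permutation_sym (leaves_ac ts); have pu := leaves_ac s'u.
case: ss' => [lt|[eq lt]]; [left|right; split=> //].
  exact: mset_ltp_perm lt.
by apply: Permutation_trans (Permutation_sym pu) _; rewrite eq.
Qed.

Lemma child_leaves t x : child x t ->
  mset_ltp leaf_lt (leaves x) (leaves t) \/
  leaves x = leaves t /\ (weight x < weight t)%N.
Proof.
case: t => //= [a u ->|a b [] ->]; first by right; split=> //; lia.
  left; apply: (mset_ltp_perm (Permutation_refl _) (Permutation_app_comm _ _)).
  exact/mset_ltp_drop/leaves_nonempty.
by left; apply/mset_ltp_drop/leaves_nonempty.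
Qed.

Definition all_good V (l : list (term K -> Prop)) : Prop :=
  forall c a, List.In c l -> c a -> good V a.

Lemma good_leaves V t : good V t -> all_good V (leaves t).
Proof.
elim: t => [n|t _|t _ u _|x t IHt|t IHt u IHu] Gt c a /=;
  try by move=> [<-|[]] /(good_ac Gt).
- exact/IHt/(good_child Gt).
- move=> /List.in_app_iff[]; first by apply/IHt/(good_child Gt); left.
  by apply/IHu/(good_child Gt); right.
Qed.

Lemma all_good_perm V l l' : Permutation l l' -> all_good V l -> all_good V l'.
Proof.
move=> p Gl c a cl'; apply: Gl; exact: Permutation_in (Permutation_sym p) cl'.
Qed.

Lemma all_good_mset V l' l :
  mset_ltp leaf_lt l' l -> all_good V l -> all_good V l'.
Proof.
elim=> {l l'} [l' l [x [c [ys [p q r]]]] Gl|l1 l2 l3 _ IH1 _ IH2 /IH2/IH1//].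
have Gxc := all_good_perm p Gl.
apply: (all_good_perm (Permutation_sym q)) => d a /List.in_app_iff[/r|dc].
  move=> [b [b' [xE bb' db']]].
  have Gb : good V b by apply: Gxc (or_introl erefl) _; rewrite xE; apply: ac_refl.
  exact: good_leaves (good_red Gb bb') _ _ db'.
by apply: Gxc; right.
Qed.

(** The clause of [good] on children takes the induction down to the leaf; the clause on reducts
    then follows its reductions. *)
Lemma Acc_leaf_lt V t c : good V t -> List.In c (leaves t) -> Acc leaf_lt c.
Proof.
move=> Gt; elim: Gt c => {}t _ _ IHc _ IHr c.
have IH x : child x t -> forall c, List.In c (leaves x) -> Acc leaf_lt c.
  by move=> xt d; apply: IHc xt d; apply: ac_refl.
have atom u : ac_eq t u -> Acc leaf_lt (ac_eq u).
  move=> tu; constructor=> d [a [a' [aE aa' da']]]; apply: IHr da'.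
  apply: ac_red_ac aa'; apply: ac_trans tu _; rewrite aE; exact: ac_refl.
have {}atom := atom t (ac_refl t).
case: t IH atom {IHc IHr} => [n|b|b b'|a b|b b'] IH atom /=;
  try by move=> [<-|[]].
- exact: IH.
- by move=> /List.in_app_iff[]; apply: IH; [left|right].
Qed.

Lemma leaves_atom t c :
  List.In c (leaves t) -> exists2 a, c = ac_eq a & leaves a = [:: ac_eq a].
Proof.
elim: t => [n|t _|t _ u _|x t IHt|t IHt u IHu] /=;
  try by move=> [<-|[]]; eexists.
- exact: IHt.
- by move=> /List.in_app_iff[].
Qed.

(** Lexicographic induction on the multiset of leaves and the weight: reducts and children of [t]
    decrease, and their leaves remain good. *)
Lemma good_of_leaves V t : all_good V (leaves t) -> good V t.
Proof.
move=> Gt; have acct : Acc (mset_ltp leaf_lt) (leaves t).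
  apply/Acc_clos_trans/Acc_mset_lt => c cin.
  have [a cE aE] := leaves_atom cin.
  have Ga : good V a by apply: Gt cin _; rewrite cE; apply: ac_refl.
  by apply: (Acc_leaf_lt Ga); rewrite cE aE; left.
move El: (leaves t) acct => l acct.
have {El} : Permutation (leaves t) l by rewrite El; apply: Permutation_refl.
elim: acct t Gt => {}l _ IHl t.
have [n] := ubnP (weight t); elim: n t => [|n IHn] t tn Gt tl.
  by rewrite ltn0 in tn.
have IH u : mset_ltp leaf_lt (leaves u) (leaves t) \/
    Permutation (leaves u) (leaves t) /\ (weight u < weight t)%N -> good V u.
  case=> [lt|[p lt]].
    apply: IHl (Permutation_refl _); last exact: all_good_mset lt Gt.
    exact: mset_ltp_perm (Permutation_refl _) tl lt.
  apply: IHn; first by lia.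
    exact: all_good_perm (Permutation_sym p) Gt.
  exact: Permutation_trans p tl.
(* For a sum or a scalar multiple only children and reducts remain to be checked; a variable,
   abstraction or application is its own leaf, except that an application could also be treated this
   way. *)
have composite : (forall a, ~ ac_eq t (Lam a)) -> good V t.
  move=> tNlam; split=> [a /tNlam//|u x tu xu|u /red_ac_leaves]; last exact: IH.
  apply: IH; rewrite (weight_ac tu).
  have p := Permutation_sym (leaves_ac tu).
  case: (child_leaves xu) => [lt|[-> lt]]; [left|right; split=> //].
  exact: mset_ltp_perm (Permutation_refl _) p lt.
case: t Gt composite {tn tl IH} => [m|a|a b|x a|a b] Gt composite;
  try by apply: (Gt _ _ (or_introl erefl)); apply: ac_refl.
- by apply: composite => c /ac_eq_inv.
- by apply: composite => c /ac_eq_inv.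
Qed.

(** * Closure of goodness under sums, scalars and application *)

Lemma good_Add V t u : good V t -> good V u -> good V (Add t u).
Proof.
move=> /good_leaves Gt /good_leaves Gu; apply: good_of_leaves => c a /=.
by move=> /List.in_app_iff[]; [apply: Gt | apply: Gu].
Qed.

Lemma good_Scale V x t : good V t -> good V (Scale x t).
Proof. by move=> /good_leaves Gt; apply: good_of_leaves. Qed.

(** Nested induction on the goodness of [t] and of [r]. The distributive rules produce applications
    of children, which is why both inductions must descend to children as well as to reducts. *)
Lemma good_App (V1 V2 V : term K -> Prop) t r :
  (forall a b, V1 a -> basis b -> good V2 b -> good V (tinst b a)) ->
  good V1 t -> good V2 r -> good V (App t r).
Proof.
move=> beta Gt; elim: Gt r => {}t GV Gc IHc Gr IHr r.
elim=> {}r HV Hc IHc2 Hr IHr2; have Gr2 : good V2 r by split.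
split; first by move=> a /ac_eq_inv.
  by move=> u x /ac_App_inv[t' [r' [-> _ _]]].
move=> u [s [s' [/ac_App_inv[t' [r' [-> tt' rr']]] ss' s'u]]].
apply: good_ac s'u.
have Ar v : ac_eq (App v r) (App v r') by apply: ac_app => //; apply: ac_refl.
have At v : ac_eq (App t v) (App t' v) by apply: ac_app => //; apply: ac_refl.
inversion ss'; subst.
- apply: good_Add; apply: good_ac (Ar _); apply: (IHc _ _ tt') Gr2.
    by left.
  by right.
- apply: good_Add; apply: good_ac (At _); apply: (IHc2 _ _ rr').
    by left.
  by right.
- by apply/good_Scale/(good_ac _ (Ar _)); apply: (IHc _ _ tt') Gr2.
- by apply/good_Scale/(good_ac _ (At _)); apply: (IHc2 _ _ rr').
- by apply: beta; [apply: GV tt' | assumption | apply: good_ac rr'].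
- by apply: good_ac (At _); apply: IHr2; apply: (ac_red_ac rr'); apply: red_red_ac.
- apply: good_ac (Ar _); apply: IHr Gr2; apply: (ac_red_ac tt').
  exact: red_red_ac.
Qed.

End Terms.

(** * Kripke frames *)

Record frame : Type := Frame {
  pt :> Type;
  le : pt -> pt -> Prop;
  le_refl : forall w, le w w;
  le_trans : forall u v w, le u v -> le v w -> le u w }.

(** The points accessible from [w] are those below it; the second clause is the back condition of
    modal logic. *)
Definition pmorphism (F' F : frame) (f : F' -> F) : Prop :=
  (forall v w, le v w -> le (f v) (f w)) /\
  (forall w v, le v (f w) -> exists2 v', le v' w & f v' = v).

Lemma pmorphism_id (F : frame) : pmorphism (fun w : F => w).
Proof. by split=> // w v vw; exists v. Qed.

Lemma pmorphism_comp (F1 F2 F3 : frame) (f : F1 -> F2) (g : F2 -> F3) :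
  pmorphism f -> pmorphism g -> pmorphism (g \o f).
Proof.
move=> [fm fo] [gm go]; split=> [v w /fm /gm //|w v /go[v2 /fo[v1 v1w <-] <-]].
by exists v1.
Qed.

(** * Pullbacks of p-morphisms *)

Section Pullback.
Variables (F1 F2 F : frame) (f1 : F1 -> F) (f2 : F2 -> F).
Hypotheses (pf1 : pmorphism f1) (pf2 : pmorphism f2).

Definition pullback_le (p q : {p : F1 * F2 | f1 p.1 = f2 p.2}) : Prop :=
  le (sval p).1 (sval q).1 /\ le (sval p).2 (sval q).2.

Lemma pullback_le_refl p : pullback_le p p.
Proof. by split; apply: le_refl. Qed.

Lemma pullback_le_trans p q r :
  pullback_le p q -> pullback_le q r -> pullback_le p r.
Proof. by move=> [pq1 pq2] [qr1 qr2]; split; eapply le_trans; eassumption. Qed.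

Definition pullback := Frame pullback_le_refl pullback_le_trans.

Definition pb1 (p : pullback) : F1 := (sval p).1.
Definition pb2 (p : pullback) : F2 := (sval p).2.

Lemma pb_comm p : f1 (pb1 p) = f2 (pb2 p).
Proof. exact: svalP p. Qed.

Lemma pmorphism_pb1 : pmorphism pb1.
Proof.
split=> [p q []//|p v1 v1p].
have [v2 v2p v2E] : exists2 v2, le v2 (pb2 p) & f2 v2 = f1 v1.
  by apply: (proj2 pf2); rewrite -pb_comm; apply: (proj1 pf1).
by exists (exist (fun p => f1 p.1 = f2 p.2) (v1, v2) (esym v2E)).
Qed.

Lemma pmorphism_pb2 : pmorphism pb2.
Proof.
split=> [p q []//|p v2 v2p].
have [v1 v1p v1E] : exists2 v1, le v1 (pb1 p) & f1 v1 = f2 v2.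
  by apply: (proj2 pf1); rewrite pb_comm; apply: (proj1 pf2).
by exists (exist (fun p => f1 p.1 = f2 p.2) (v1, v2) v1E).
Qed.

End Pullback.

(** * Two frames glued below a common one *)

Section Amalgam.
Variables (F1 F2 F : frame) (f1 : F1 -> F) (f2 : F2 -> F).
Hypotheses (pf1 : pmorphism f1) (pf2 : pmorphism f2).

(** The copies of [F1] and [F2] are mutually incomparable, but a point of each acquires a common
    upper bound as soon as their images have one. *)
Definition amalgam_le (p q : F1 + F2 + F) : Prop :=
  match p, q with
  | inl (inl a), inl (inl b) => le a b
  | inl (inr a), inl (inr b) => le a b
  | inl (inl a), inr y => le (f1 a) y
  | inl (inr a), inr y => le (f2 a) y
  | inr x, inr y => le x y
  | _, _ => False
  end.

Lemma amalgam_le_refl p : amalgam_le p p.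
Proof. by case: p => [[]|] a /=; apply: le_refl. Qed.

Lemma amalgam_le_trans p q r :
  amalgam_le p q -> amalgam_le q r -> amalgam_le p r.
Proof.
case: p => [[]|] a; case: q => [[]|] b; case: r => [[]|] c //=;
  try exact: le_trans.
- by move=> /(proj1 pf1); apply: le_trans.
- by move=> /(proj1 pf2); apply: le_trans.
Qed.

Definition amalgam := Frame amalgam_le_refl amalgam_le_trans.

Definition amalgam_map (p : amalgam) : F :=
  match p with inl (inl a) => f1 a | inl (inr a) => f2 a | inr x => x end.

Lemma pmorphism_amalgam_map : pmorphism amalgam_map.
Proof.
split=> [p q|p v]; last first.
  case: p => [[]|] a /=.
  - by move=> /(proj2 pf1)[a' a'a <-]; exists (inl (inl a')).
  - by move=> /(proj2 pf2)[a' a'a <-]; exists (inl (inr a')).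
  - by exists (inr v).
case: p => [[]|] a; case: q => [[]|] b //=;
  [exact: (proj1 pf1) | exact: (proj1 pf2)].
Qed.

Lemma pmorphism_amalgam1 : pmorphism (fun a : F1 => inl (inl a) : amalgam).
Proof. by split=> // a [[]|] b //= ba; exists b. Qed.

Lemma pmorphism_amalgam2 : pmorphism (fun a : F2 => inl (inr a) : amalgam).
Proof. by split=> // a [[]|] b //= ba; exists b. Qed.

End Amalgam.

(** * Interpretation of types *)

Section Interpretation.
Variable K : comPzRingType.
Implicit Types F : frame.

(** As in [good], the terms are bodies of abstractions. *)
Definition cand (F : frame) : Type := F -> term K -> Prop.

Definition is_cand (F : frame) (C : cand F) : Prop :=
  (forall v w a, le v w -> C w a -> C v a) /\ (forall w, stable (C w)).

Definition env (F : frame) : Type := vsort -> nat -> cand F.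

Definition is_env (F : frame) (e : env F) : Prop := forall X n, is_cand (e X n).

Definition extend (F : frame) (X : vsort) (C : cand F) (e : env F) : env F :=
  fun Y => match X, Y with
           | SUnit, SUnit | SGen, SGen => scons C (e Y)
           | _, _ => e Y
           end.

Definition pullc (F' F : frame) (f : F' -> F) (C : cand F) : cand F' :=
  fun w => C (f w).

Definition pull (F' F : frame) (f : F' -> F) (e : env F) : env F' :=
  fun X n => pullc f (e X n).

(** Abstract in [I], so that it also applies to a union of interpretations. Admitting every point
    over something below [w] makes the result monotone. *)
Definition all_sem (I : forall F, env F -> cand F) X F (e : env F) : cand F :=
  fun w a => forall (F' : frame) (f : F' -> F) w' (C : cand F'),
    pmorphism f -> le (f w') w -> is_cand C -> I F' (extend X C (pull f e)) w' a.

(** The arrow is a Kripke implication tested on basis arguments, the only ones that fire the beta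
    rule. *)
Fixpoint usem (U : uty K) (F : frame) (e : env F) {struct U} : cand F :=
  match U with
  | UVar n => e SUnit n
  | UArr U T => fun w a => forall v b, le v w -> basis b ->
      good (usem U e v) b -> good (gsem T e v) (tinst b a)
  | UAll U => all_sem (usem U) SUnit e
  | UAllG U => all_sem (usem U) SGen e
  end
with gsem (T : gty K) (F : frame) (e : env F) {struct T} : cand F :=
  match T with
  | GUnit U => usem U e
  | GScale _ T => gsem T e
  | GAdd T R => fun w a => gsem T e w a \/ gsem R e w a
  | GVar n => e SGen n
  end.

Scheme uty_mut := Induction for uty Sort Prop
with gty_mut := Induction for gty Sort Prop.
Combined Scheme ty_mut from uty_mut, gty_mut.

Lemma usem_uall X U F (e : env F) : usem (uall X U) e = all_sem (usem U) X e.
Proof. by case: X. Qed.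

Lemma cand_ext F (C D : cand F) : (forall w a, C w a <-> D w a) -> C = D.
Proof.
move=> CD; apply: functional_extensionality => w.
by apply: functional_extensionality => a; apply: propositional_extensionality.
Qed.

Lemma env_ext F (e e' : env F) : (forall X n, e X n = e' X n) -> e = e'.
Proof.
by move=> ee'; do 2![apply: functional_extensionality => ?].
Qed.

Lemma pull_extend F' F (f : F' -> F) X C (e : env F) :
  pull f (extend X C e) = extend X (pullc f C) (pull f e).
Proof. by apply: env_ext => Y [|n]; case: X; case: Y. Qed.

Lemma is_cand_pullc F' F (f : F' -> F) C :
  pmorphism f -> is_cand C -> is_cand (pullc f C).
Proof. by move=> [fm _] [Cm Cs]; split=> [v w a /fm /Cm|w]; [apply | apply: Cs]. Qed.

Lemma is_env_pull F' F (f : F' -> F) e :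
  pmorphism f -> is_env e -> is_env (pull f e).
Proof. by move=> pf ce X n; apply: is_cand_pullc. Qed.

Lemma is_env_extend F X C (e : env F) :
  is_cand C -> is_env e -> is_env (extend X C e).
Proof.
by move=> cC ce Y; case: X; case: Y => n; rewrite /extend; case: n => *;
  try apply: ce.
Qed.

(** Invariance of truth under p-morphisms, which lets an interpretation be moved between frames. *)
Definition natural (I : forall F, env F -> cand F) : Prop :=
  forall F' F (f : F' -> F) (e : env F), pmorphism f ->
    I F' (pull f e) = pullc f (I F e).

(** One direction composes p-morphisms. In the other, an instance over [g] is moved to the pullback
    of [g] and [f]: the back condition for [f] gives the point, the candidate is pulled back along
    the first projection, and naturality of [I] brings the result back. *)
Lemma natural_all_sem I X : natural I -> natural (all_sem I X).
Proof.
move=> nI F' F f e pf; apply: cand_ext => w a; rewrite /all_sem /pullc.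
split=> H F2 g w2 C pg gw cC; last first.
  exact: H _ (f \o g) w2 C (pmorphism_comp pg pf) (proj1 pf _ _ gw) cC.
have [v vw vE] := proj2 pf _ _ gw.
pose p : pullback g f := exist (fun p => g p.1 = f p.2) (w2, v) (esym vE).
have p1 := pmorphism_pb1 pg pf; have p2 := pmorphism_pb2 pg pf.
have := H _ (@pb2 _ _ _ g f) p (pullc (@pb1 _ _ _ g f) C) p2 vw
          (is_cand_pullc p1 cC).
suff -> : extend X (pullc (@pb1 _ _ _ g f) C) (pull (@pb2 _ _ _ g f) (pull f e)) =
          pull (@pb1 _ _ _ g f) (extend X C (pull g e)) by rewrite nI.
rewrite pull_extend; congr extend; apply: env_ext => Y n.
by apply: functional_extensionality => q; rewrite /pull /pullc pb_comm.
Qed.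

Lemma natural_sem :
  (forall U, natural (usem U)) /\ (forall T, natural (gsem T)).
Proof.
apply: ty_mut => //=; try by move=> U; apply: natural_all_sem.
- move=> U IHU T IHT F' F f e pf; apply: cand_ext => w a /=.
  rewrite (IHU _ _ _ _ pf) (IHT _ _ _ _ pf); split=> H v b.
    move=> /(proj2 pf)[v' v'w <-]; exact: H.
  by move=> /(proj1 pf); apply: H.
- by move=> T IHT R IHR F' F f e pf; rewrite /= (IHT _ _ _ _ pf) (IHR _ _ _ _ pf).
Qed.

Definition natural_usem := proj1 natural_sem.
Definition natural_gsem := proj2 natural_sem.

Lemma is_cand_all_sem I X F (e : env F) :
  (forall F' (e' : env F'), is_env e' -> is_cand (I F' e')) ->
  is_env e -> is_cand (all_sem I X e).
Proof.
move=> cI ce; split=> [v w a vw H|w].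
  by move=> F' f w' C pf /le_trans-/(_ _ vw); apply: H.
split=> a b H ab F' f w' C pf fw cC;
  have [_ /(_ w')[Iac Ired]] := cI _ _ (is_env_extend X cC (is_env_pull pf ce)).
- exact: Iac (H _ _ _ _ pf fw cC) ab.
- exact: Ired (H _ _ _ _ pf fw cC) ab.
Qed.

Lemma is_cand_sem :
  (forall U F (e : env F), is_env e -> is_cand (usem U e)) /\
  (forall T F (e : env F), is_env e -> is_cand (gsem T e)).
Proof.
apply: ty_mut => /=.
- by move=> n F e ce; apply: ce.
- move=> U IHU T IHT F e ce; split=> [v w a vw H u b uv|w].
    exact: H (le_trans uv vw).
  split=> a c H ac v b vw bb Gb; have Ga := H v b vw bb Gb.
    exact/(good_ac Ga)/ac_tsubst.
  exact/(good_red Ga)/red_ac_tinst.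
- by move=> U IHU F e; apply: is_cand_all_sem.
- by move=> U IHU F e; apply: is_cand_all_sem.
- by [].
- by [].
- move=> T IHT R IHR F e ce.
  have [Tm Ts] := IHT _ _ ce; have [Rm Rs] := IHR _ _ ce.
  split=> [v w a vw [/(Tm _ _ _ vw)|/(Rm _ _ _ vw)]|w]; [by left|by right|].
  have [Tac Tred] := Ts w; have [Rac Rred] := Rs w.
  by split=> a b [Ha|Ha] ab; [left; apply: Tac ab | right; apply: Rac ab
                            | left; apply: Tred ab | right; apply: Rred ab].
- by move=> n F e ce; apply: ce.
Qed.

Definition is_cand_usem := proj1 is_cand_sem.
Definition is_cand_gsem := proj2 is_cand_sem.

(* A point of [F1] where [I] fails and a point of [F2] where [J] fails are
   placed below a common point of the amalgam, where by monotonicity both fail;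
   the new candidate is empty on the points that come from [F]. *)
Lemma all_sem_or I J X F (e : env F) w a :
  natural I -> natural J ->
  (forall F' (e' : env F'), is_env e' -> is_cand (I F' e')) ->
  (forall F' (e' : env F'), is_env e' -> is_cand (J F' e')) ->
  is_env e ->
  all_sem (fun F' e' w' a' => I F' e' w' a' \/ J F' e' w' a') X e w a ->
  all_sem I X e w a \/ all_sem J X e w a.
Proof.
move=> nI nJ cI cJ ce H; apply: NNPP => /not_or_and[NI NJ].
apply: NI => F1 f1 w1 C1 pf1 fw1 cC1; apply: NNPP => NI1.
apply: NJ => F2 f2 w2 C2 pf2 fw2 cC2; apply: NNPP => NJ2.
pose G := amalgam pf1 pf2; pose g : G -> F := @amalgam_map _ _ _ _ _ pf1 pf2.
have pg : pmorphism g := pmorphism_amalgam_map pf1 pf2.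
pose C : cand G := fun p => match p with
  | inl (inl x) => C1 x | inl (inr x) => C2 x | inr _ => fun=> False end.
have cC : is_cand C.
  split=> [|[[]|] x /=]; last by split.
  - by case=> [[]|] x [[]|] y c //=; [apply: (proj1 cC1) | apply: (proj1 cC2)].
  - exact: (proj2 cC1).
  - exact: (proj2 cC2).
have cE : is_env (extend X C (pull g e)) by apply/is_env_extend/is_env_pull.
case: (H G g (inr w) C pg (le_refl _) cC) => [HI|HJ]; [apply: NI1|apply: NJ2].
- have := proj1 (cI _ _ cE) (inl (inl w1) : G) (inr w : G) a fw1 HI.
  have <- : pull (fun x : F1 => inl (inl x) : G) (extend X C (pull g e)) =
            extend X C1 (pull f1 e) by rewrite pull_extend.
  by rewrite nI //; apply: pmorphism_amalgam1.
- have := proj1 (cJ _ _ cE) (inl (inr w2) : G) (inr w : G) a fw2 HJ.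
  have <- : pull (fun x : F2 => inl (inr x) : G) (extend X C (pull g e)) =
            extend X C2 (pull f2 e) by rewrite pull_extend.
  by rewrite nJ //; apply: pmorphism_amalgam2.
Qed.

Lemma gsem_gsum n G F (e : env F) w a :
  gsem (gsum n G) e w a <-> exists2 i, (i <= n)%N & gsem (G i) e w a.
Proof.
elim: n => [|n IHn] /=.
  by split=> [H|[[|//] _ H]] //; exists 0%N.
rewrite IHn; split=> [[[i i_n H]|H]|[i i_n H]].
- by exists i => //; lia.
- by exists n.+1.
- move: i_n H; rewrite leq_eqVlt => /orP[/eqP->|i_n] H; first by right.
  by left; exists i.
Qed.

(** The commutation of the quantifier with finite unions on which [ty_allI] rests; [all_sem_or]
    splits off one summand at a time. *)
Lemma all_sem_gsum X n (alpha : nat -> K) U F (e : env F) w a : is_env e ->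
  all_sem (gsem (gsum n (fun i => GScale (alpha i) (GUnit (U i))))) X e w a ->
  gsem (gsum n (fun i => GScale (alpha i) (GUnit (uall X (U i))))) e w a.
Proof.
move=> ce; elim: n => [|n IHn] /= H; first by rewrite usem_uall.
rewrite usem_uall; case: (all_sem_or _ _ _ _ ce H) => [||||/IHn|] //;
  by [left | right | apply: natural_gsem | apply: natural_usem
     | apply: is_cand_gsem | apply: is_cand_usem].
Qed.

(** * Renaming, substitution and equivalence of types *)

Definition ren_env (xu xg : nat -> nat) F (e : env F) : env F :=
  fun Y n => if Y is SUnit then e SUnit (xu n) else e SGen (xg n).

Lemma sem_ren :
  (forall U xu xg F (e : env F), usem (uren xu xg U) e = usem U (ren_env xu xg e)) /\
  (forall T xu xg F (e : env F), gsem (gren xu xg T) e = gsem T (ren_env xu xg e)).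
Proof.
apply: ty_mut => //=.
- by move=> U IHU T IHT xu xg F e; rewrite IHU IHT.
- move=> U IHU xu xg F e; apply: cand_ext => w a; rewrite /all_sem.
  by split=> H F' f w' C pf fw cC; have := H F' f w' C pf fw cC; rewrite IHU;
    congr (usem U _ _ _); apply: env_ext => -[] [].
- move=> U IHU xu xg F e; apply: cand_ext => w a; rewrite /all_sem.
  by split=> H F' f w' C pf fw cC; have := H F' f w' C pf fw cC; rewrite IHU;
    congr (usem U _ _ _); apply: env_ext => -[] [].
- by move=> T IHT R IHR xu xg F e; rewrite IHT IHR.
Qed.

Definition usem_ren := proj1 sem_ren.
Definition gsem_ren := proj2 sem_ren.

Definition sub_env (su : nat -> uty K) (sg : nat -> gty K) F (e : env F) : env F :=
  fun Y n => if Y is SUnit then usem (su n) e else gsem (sg n) e.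

Lemma ren_env_succu F C (e : env F) : ren_env succn id (extend SUnit C e) = e.
Proof. by apply: env_ext => -[]. Qed.

Lemma ren_env_succg F C (e : env F) : ren_env id succn (extend SGen C e) = e.
Proof. by apply: env_ext => -[]. Qed.

(** Under a quantifier the environment lives on another frame, so besides weakening the substituted
    types, naturality must move their interpretations along [f]. *)
Lemma sem_subst :
  (forall U su sg F (e : env F),
     usem (usubst su sg U) e = usem U (sub_env su sg e)) /\
  (forall T su sg F (e : env F),
     gsem (gsubst su sg T) e = gsem T (sub_env su sg e)).
Proof.
apply: ty_mut => //=.
- by move=> U IHU T IHT su sg F e; rewrite IHU IHT.
- move=> U IHU su sg F e; apply: cand_ext => w a; rewrite /all_sem.
  suff E F' (f : F' -> F) C : pmorphism f ->
      sub_env (scons (UVar 0) (uren succn id \o su)) (gren succn id \o sg)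
              (extend SUnit C (pull f e)) =
      extend SUnit C (pull f (sub_env su sg e)).
    by split=> H F' f w' C pf fw cC; have := H F' f w' C pf fw cC;
      rewrite IHU E.
  move=> pf {IHU}; apply: env_ext => -[[|n]|n]; rewrite /sub_env /=.
  + by [].
  + by rewrite usem_ren ren_env_succu (natural_usem _ _ pf).
  + by rewrite gsem_ren ren_env_succu (natural_gsem _ _ pf).
- move=> U IHU su sg F e; apply: cand_ext => w a; rewrite /all_sem.
  suff E F' (f : F' -> F) C : pmorphism f ->
      sub_env (uren id succn \o su) (scons (GVar 0) (gren id succn \o sg))
              (extend SGen C (pull f e)) =
      extend SGen C (pull f (sub_env su sg e)).
    by split=> H F' f w' C pf fw cC; have := H F' f w' C pf fw cC;
      rewrite IHU E.
  move=> pf {IHU}; apply: env_ext => -[n|[|n]]; rewrite /sub_env /=.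
  + by rewrite usem_ren ren_env_succg (natural_usem _ _ pf).
  + by [].
  + by rewrite gsem_ren ren_env_succg (natural_gsem _ _ pf).
- by move=> T IHT R IHR su sg F e; rewrite IHT IHR.
Qed.

Definition usem_subst := proj1 sem_subst.
Definition gsem_subst := proj2 sem_subst.

Definition asem (A : targ K) F (e : env F) : cand F :=
  match A with AUnit U => usem U e | AGen T => gsem T e end.

Lemma is_cand_asem A F (e : env F) : is_env e -> is_cand (asem A e).
Proof. by case: A => *; [apply: is_cand_usem | apply: is_cand_gsem]. Qed.

(** All of [As] is read in the fixed [e] while [d] grows, which makes the substitution
    simultaneous. *)
Definition extends F (e : env F) (As : seq (targ K)) (d : env F) : env F :=
  foldl (fun d A => extend (sort_of A) (asem A e) d) d As.

Lemma sub_env_inst As F (e : env F) :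
  sub_env (inst_env As).1 (inst_env As).2 e = extends e As e.
Proof.
rewrite /inst_env; set step := (X in foldl X).
have E s : sub_env (foldl step s As).1 (foldl step s As).2 e =
    extends e As (sub_env s.1 s.2 e).
  elim: As s => //= A As IH s; rewrite IH; congr (extends e As _).
  by case: A => B; apply: env_ext => -[] [].
by rewrite E; congr (extends e As _); apply: env_ext => -[].
Qed.

Lemma usem_inst As U F (e : env F) : usem (uinst As U) e = usem U (extends e As e).
Proof. by rewrite usem_subst sub_env_inst. Qed.

Lemma gsem_inst As T F (e : env F) : gsem (ginst As T) e = gsem T (extends e As e).
Proof. by rewrite gsem_subst sub_env_inst. Qed.

Lemma usem_ualls As U F (e d : env F) w a : is_env e ->
  usem (ualls (map (@sort_of K) As) U) d w a -> usem U (extends e As d) w a.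
Proof.
move=> ce; elim: As d => //= A As IH d; rewrite usem_uall => H; apply: IH.
exact: H F id w _ (pmorphism_id F) (le_refl w) (is_cand_asem A ce).
Qed.

(** Union is associative, commutative and idempotent; idempotence accounts for factorisation. *)
Lemma gsem_equiv T R F (e : env F) : gequiv T R -> gsem T e = gsem R e.
Proof.
move=> TR; elim: TR F e => {T R} //=.
- by move=> a b T F e; apply: cand_ext => w c; tauto.
- by move=> T R F e; apply: cand_ext => w c; tauto.
- by move=> T R V F e; apply: cand_ext => w c; tauto.
- by move=> T R V _ IH1 _ IH2 F e; rewrite IH1.
- by move=> U U' T T' _ IHU _ IHT F e; rewrite IHU IHT.
- move=> X U U' _ IH F e; rewrite !usem_uall; apply: cand_ext => w a.
  by rewrite /all_sem; split=> H F' f w' C pf fw cC; have := H F' f w' C pf fw cC;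
    rewrite IH.
- by move=> T T' R R' _ IHT _ IHR F e; rewrite IHT IHR.
Qed.

(** * Adequacy *)

(** The point varies because arrows look below it, and the frame because quantifiers look at the
    frames over it. *)
Lemma adequacy Gamma t T : typing Gamma t T ->
  forall F (e : env F) w s, is_env e -> (forall n, basis (s n)) ->
  (forall n U, onth Gamma n = Some U -> good (usem U e w) (s n)) ->
  good (gsem T e w) (tsubst s t).
Proof.
elim=> {Gamma t T} /=.
- by move=> Gamma x U xU F e w s _ _; apply.
- by move=> Gamma t T R _ IH /gsem_equiv TR F e w s ce bs Gs; rewrite TR; apply: IH.
- move=> Gamma U t T _ IH F e w s ce bs Gs.
  have Gt v b : le v w -> basis b -> good (usem U e v) b ->
      good (gsem T e v) (tinst b (tsubst (tup s) t)).
    move=> vw bb Gb; rewrite tinst_tup.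
    apply: (IH F e v _ ce (basis_scons bb bs)).
    move=> [|n] V /=; first by case=> <-; exact: Gb.
    move=> /Gs; apply: good_sub => a; exact: (proj1 (is_cand_usem V ce)).
  apply: good_Lam; [exact: (proj2 (is_cand_usem (UArr U T) ce))| |exact: Gt].
  (* A variable is a basis term and is good for every set, so the body terminates because its
     instance at [Var 0] does. *)
  apply: (@SN_tinst_inv _ (Var 0) _ erefl).
  exact: good_SN (Gt w (Var 0) (le_refl w) erefl (good_Var _ 0)).
- move=> Gamma t r Xs U n alpha T m beta A AXs _ IHt _ IHr F e w s ce bs Gs.
  apply: good_App (IHt _ _ _ _ ce bs Gs) (IHr _ _ _ _ ce bs Gs) => a b.
  move=> /gsem_gsum[i i_n /= Ha] bb Gb.
  (* A basis argument selects a single summand: the body of an abstraction lies in some component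
     [j], and a variable is good for all of them, so [0] serves. *)
  have [j j_m Gbj] : exists2 j, (j <= m)%N & good (usem (uinst (A j) U) e w) b.
    case: b bb Gb => [x|b|? ?|? ?|? ?] // _ Gb.
      by exists 0%N; [|exact: good_Var].
    have /gsem_gsum[j j_m /= Hb] := good_body Gb; exists j; first by [].
    by apply: good_Lam Hb; [exact: (proj2 (is_cand_usem _ ce))
                          | exact: SN_body (good_SN Gb)].
  rewrite -(AXs j j_m) in Ha.
  have {}Ha := usem_ualls ce Ha.
  rewrite usem_inst in Gbj.
  have := Ha w b (le_refl w) bb Gbj; apply: good_sub => c Hc.
  apply/gsem_gsum; exists i => //; apply/gsem_gsum; exists j => //=.
  by rewrite gsem_inst.
- move=> Gamma t X n alpha U _ IH F e w s ce bs Gs.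
  have Gt F' (f : F' -> F) w' C : pmorphism f -> le (f w') w -> is_cand C ->
      good (gsem (gsum n (fun i => GScale (alpha i) (GUnit (U i))))
              (extend X C (pull f e)) w') (tsubst s t).
    move=> pf fw cC; 
    apply: (IH _ _ _ _ (is_env_extend X cC (is_env_pull pf ce)) bs).
    move=> x V; rewrite onth_map; case xW: (onth Gamma x) => [W|]; last by [].
    case=> <- {V}.
    have Gx := Gs x W xW.
    (* The context does not see the new variable, so its types keep their meaning at [f w'], and
       [f w'] is below [w]. *)
    have -> : usem (ushift X W) (extend X C (pull f e)) = pullc f (usem W e).
      by rewrite -natural_usem //; case: (X) => /=;
        rewrite usem_ren ?ren_env_succu ?ren_env_succg.
    apply: good_sub Gx => a; exact: (proj1 (is_cand_usem W ce)).
  set S := gsum n _ in Gt.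
  (* The family of all instances of the quantifier: a body lying in each of them is in [all_sem] of
     the whole sum. *)
  apply: (@good_inter _ (fun V => exists F' (f : F' -> F) w' C,
    [/\ pmorphism f, le (f w') w, is_cand C
      & V = gsem S (extend X C (pull f e)) w'])).
  (* The family is nonempty: [e X 0] is just some candidate on the current frame. *)
  + exists F, id, w, (e X 0%N); split; last reflexivity;
      [exact: pmorphism_id | exact: le_refl | exact: ce].
  + by move=> V [F' [f [w' [C [pf fw cC ->]]]]]; apply: Gt.
  + move=> a Ha; apply: all_sem_gsum => // F' f w' C pf fw cC.
    by apply: Ha; exists F', f, w', C.
- move=> Gamma t A n alpha U _ IH F e w s ce bs Gs.
  have := IH F e w s ce bs Gs; apply: good_sub => a /gsem_gsum[i i_n /=].
  rewrite usem_uall => H; apply/gsem_gsum; exists i => //=; rewrite usem_inst.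
  exact: H F id w _ (pmorphism_id F) (le_refl w) (is_cand_asem A ce).
- move=> Gamma t r T R _ IHt _ IHr F e w s ce bs Gs; apply: good_Add.
    by apply: good_sub (IHt F e w s ce bs Gs) => a; left.
  by apply: good_sub (IHr F e w s ce bs Gs) => a; right.
- move=> Gamma t T _ IH F e w s ce bs Gs.
  exact: good_red (IH F e w s ce bs Gs) (red_red_ac (red_one _)).
- move=> Gamma t n alpha T _ IH F e w s ce bs Gs; apply: good_Scale.
  apply: good_sub (IH 0%N (leq0n n) F e w s ce bs Gs) => a Ha.
  by apply/gsem_gsum; exists 0%N.
Qed.

End Interpretation.

Theorem theorem3 (K : comPzRingType) (Gamma : seq (uty K)) (t : term K)
    (T : gty K) :
  typing Gamma t T -> strongly_normalising t.
Proof.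
(* On the one-point frame, with empty candidates and the identity substitution, adequacy speaks of
   [t] itself, since variables are always good. *)
move=> tT; pose F := @Frame unit (fun _ _ => True) (fun=> I) (fun _ _ _ _ _ => I).
pose e : env K F := fun _ _ _ _ => False.
have := @adequacy K Gamma t T tT F e tt Var; rewrite tsubst_Var => Gt.
by apply/SN_no_infinite/good_SN/Gt => [X n|n|n U _];
  [split=> // w; split | | exact: good_Var].
Qed.
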